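(* Let $\{X_n\}_{n\ge 0}$ be the reflecting random walk on the half-strip $S=\{0,1,2,\ldots\}\times\{1,\ldots,d\}$ with blocks $P_0$ and $(P_n,Q_n,R_n)_{n\ge1}$ satisfying conditions $C_1$, $C_2$, $C_3$ (all as described in the context), started from layer $0$ with an initial distribution $\mu$ (a probability row vector of length $d$). Define $$\beta^{+}=\sum_{k=0}^{\infty}\mu_k A_k^{+}A_{k-1}^{+}\cdots A_1^{+}\mathbf 1,\qquad \mu_k=\mu\,\zeta_0^{+}\zeta_1^{+}\cdots\zeta_{k-1}^{+},$$ where empty products are the identity matrix (so $\mu_0=\mu$ and the $k=0$ term is $\mu\mathbf 1$). Then the random walk is recurrent if and only if $\beta^{+}=\infty$.
   Context: Setting: let $d\ge 1$ be an integer. $X_n=(\xi_n,Y_n)$, $n\ge0$, is a time-homogeneous Markov chain on $S=\{0,1,2,\ldots\}\times\{1,\ldots,d\}$; layer $n$ is $L_n=\{(n,i):1\le i\le d\}$. There are nonnegative $d\times d$ matrices $P_0$ and $P_n,Q_n,R_n$ ($n\ge1$) with $P_0\mathbf 1=\mathbf 1$ and $(P_n+Q_n+R_n)\mathbf 1=\mathbf 1$ for $n\ge 1$, where $\mathbf 1$ is the column vector of ones. From $(0,i)$ the chain moves to $(1,j)$ with probability $P_0(i,j)$; from $(n,i)$ with $n\ge1$ it moves to $(n+1,j)$, $(n,j)$, $(n-1,j)$ with probability $P_n(i,j)$, $R_n(i,j)$, $Q_n(i,j)$ respectively. Standing conditions (under which the chain is irreducible), with $\|B\|=\max_i\sum_j|b_{ij}|$: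 $C_1$: for every $n\ge1$, $\log(1-\|R_n+P_n\|)^{-1}<\infty$ and $\log(1-\|R_n+Q_n\|)^{-1}<\infty$ (i.e. both norms are $<1$). $C_2$: for every $n$ and $j$, $\sum_{i=1}^d P_n(i,j)>0$ ($n\ge0$) and $\sum_{i=1}^d Q_n(i,j)>0$ ($n\ge1$). $C_3$: all states of layer $0$ lie in one communication class. Definitions: $\zeta_0^{+}=P_0$ and, for $n\ge1$, $\zeta_n^{+}=(I-Q_n\zeta_{n-1}^{+}-R_n)^{-1}P_n$; each $\zeta_n^+$ is a stochastic matrix and the inverse exists. For $n\ge1$, $A_n^{+}=(I-Q_n\zeta_{n-1}^{+}-R_n)^{-1}Q_n$. A layer $y$ is called recurrent if the walk started in $L_y$ returns to $L_y$ at some time $\geq 1$ with probability one (from every state of $L_y$); the walk is recurrent if its layers are recurrent (equivalently, the irreducible chain is recurrent). *)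

(* Defs.v *)
From HB Require Import structures.
From mathcomp Require Import all_boot all_order all_algebra.
From mathcomp Require Import all_classical all_reals all_analysis.
Set Implicit Arguments.
Unset Strict Implicit.
Unset Printing Implicit Defensive.
Import Order.TTheory GRing.Theory Num.Theory.
Import numFieldNormedType.Exports.
Local Open Scope classical_set_scope.
Local Open Scope ring_scope.

(* The blocks are sequences P, Q, T of d x d matrices, T standing for the
   blocks R_n of transitions inside a layer (R is the field of reals).
   Only P is used at index 0: the values Q 0 and T 0 are never constrained
   and never matter. *)

Notation state d := (nat * 'I_d)%type.

Definition ones {R : realType} {d : nat} : 'cV[R]_d := const_mx 1.

Definition mxnorm_inf {R : realType} {d : nat} (B : 'M[R]_d) : R :=
  \big[Num.max/0]_(i < d) \sum_(j < d) `|B i j|.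

Section Walk.
Variables (R : realType) (d : nat).
Implicit Types P Q T : nat -> 'M[R]_d.

Definition nonneg_mx (B : 'M[R]_d) : Prop := forall i j, 0 <= B i j.

Definition blocks P Q T : Prop :=
  [/\ nonneg_mx (P 0%N),
      P 0%N *m ones = ones,
      forall n, (0 < n)%N ->
        [/\ nonneg_mx (P n), nonneg_mx (Q n) & nonneg_mx (T n)]
    & forall n, (0 < n)%N -> (P n + Q n + T n) *m ones = ones].

Definition step P Q T (s t : state d) : R :=
  let: (n, i) := s in let: (m, j) := t in
  if n == 0%N then if m == 1%N then P 0%N i j else 0
  else if m == n.+1 then P n i j
  else if m == n then T n i j
  else if m.+1 == n then Q n i j
  else 0.

Definition C1 P Q T : Prop :=
  forall n, (0 < n)%N ->
    mxnorm_inf (T n + P n) < 1 /\ mxnorm_inf (T n + Q n) < 1.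

Definition C2 P Q : Prop :=
  (forall n j, 0 < \sum_(i < d) P n i j) /\
  (forall n j, (0 < n)%N -> 0 < \sum_(i < d) Q n i j).

Definition accessible (p : state d -> state d -> R) (s t : state d) : Prop :=
  exists2 l : seq (state d), path (fun u v => 0 < p u v) s l & last s l = t.

Definition C3 P Q T : Prop :=
  forall i j : 'I_d, accessible (step P Q T) (0%N, i) (0%N, j).

Definition distribution_row (mu : 'rV[R]_d) : Prop :=
  (forall i, 0 <= mu 0 i) /\ \sum_(i < d) mu 0 i = 1.

Definition init_layer0 (mu : 'rV[R]_d) (s : state d) : R :=
  if s.1 == 0%N then mu 0 s.2 else 0.

Definition init_at (s t : state d) : R := (t == s)%:R.

Section Chain.
Context (disp : measure_display) (Omega : measurableType disp).
Implicit Types (Pr : probability Omega R) (X : nat -> Omega -> state d).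

Definition trajectory X (n : nat) (s : nat -> state d) : set Omega :=
  [set w | forall k, (k <= n)%N -> X k w = s k].

(* The last clause is the Markov property
   Pr(X_(n+1) = s_(n+1) | X_0 = s_0, ..., X_n = s_n) = p (s_n, s_(n+1))
   multiplied by the probability of the conditioning event. Since the state
   space is countable, measurability is required on singletons only. *)
Definition markov_chain Pr X (init : state d -> R)
    (p : state d -> state d -> R) : Prop :=
  [/\ forall n s, measurable (X n @^-1` [set s]),
      forall s, Pr (X 0%N @^-1` [set s]) = (init s)%:E
    & forall n (s : nat -> state d),
        Pr (trajectory X n.+1 s) =
        (Pr (trajectory X n s) * (p (s n) (s n.+1))%:E)%E].

(* Prs s is the law under which the walk starts at the state s. *)
Definition recurrent_layer (Prs : state d -> probability Omega R) X (y : nat) :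
    Prop :=
  forall i : 'I_d,
    Prs (y, i) [set w | exists2 n, (0 < n)%N & (X n w).1 = y] = 1%E.

Definition recurrent (Prs : state d -> probability Omega R) X : Prop :=
  forall y, recurrent_layer Prs X y.

End Chain.

Fixpoint zeta P Q T (n : nat) : 'M[R]_d :=
  if n is n'.+1 then invmx (1%:M - Q n *m zeta P Q T n' - T n) *m P n
  else P 0%N.

(* Meaningful for n >= 1 only. *)
Definition A_plus P Q T (n : nat) : 'M[R]_d :=
  invmx (1%:M - Q n *m zeta P Q T n.-1 - T n) *m Q n.

(* A_k A_(k-1) ... A_1 *)
Fixpoint A_prod P Q T (k : nat) : 'M[R]_d :=
  if k is k'.+1 then A_plus P Q T k *m A_prod P Q T k' else 1%:M.

Fixpoint mu_at P Q T (mu : 'rV[R]_d) (k : nat) : 'rV[R]_d :=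
  if k is k'.+1 then mu_at P Q T mu k' *m zeta P Q T k' else mu.

Definition beta_plus P Q T (mu : 'rV[R]_d) : \bar R :=
  (\sum_(0 <= k <oo)
     ((mu_at P Q T mu k *m A_prod P Q T k *m ones) 0 0)%:E)%E.

End Walk.

Arguments init_at {R d} s t.

(* Main.v *)
Require Import Defs.
From HB Require Import structures.
From mathcomp Require Import all_boot all_order all_algebra.
From mathcomp Require Import all_classical all_reals all_analysis.
From mathcomp Require Import lra ring.
Set Implicit Arguments.
Unset Strict Implicit.
Unset Printing Implicit Defensive.
Import Order.TTheory GRing.Theory Num.Theory.
Import numFieldNormedType.Exports.
Local Open Scope classical_set_scope.
Local Open Scope ring_scope.

(* Let f_K(n, i) be the expected number of visits to layer 0 before the walk
   started at (n, i) hits layer K. The recursion f_K(n) = v_n + zeta_n f_K(n+1),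
   with v_n = A_n ... A_1 1, shows that mu f_K(0) is the K-th partial sum of
   beta, and that f_K = 1_(layer 0) + p f_K below layer K, where p is the
   transition operator.
   If layer 0 is recurrent, let eps bound the probability of not returning to it
   within N steps. For K > N, stopping the walk at its first return gives
   min f_K(0) >= 1 + (1 - eps) min f_K(0), so min f_K(0) >= 1/eps and beta is
   infinite.
   If layer y is not recurrent, g(s) = P_s(the walk visits layer y at a time
   >= 0) is superharmonic, strictly so at some (y, i). Applying p to a
   superharmonic function moves strictness back along a transition, so
   irreducibility yields a w >= 0 with w >= 1_(layer 0) + p w. Then
   w(n) >= v_n + zeta_n w(n+1), so beta <= mu w(0) is finite. *)

(** * Nonnegative matrices with row sums below one *)

Section NonnegativeMatrices.
Context {R : realType}.

Definition mx_ge0 {m n : nat} (B : 'M[R]_(m, n)) : Prop :=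
  forall i j, 0 <= B i j.

Lemma mx_ge0_const {m n : nat} (x : R) :
  0 <= x -> mx_ge0 (const_mx x : 'M[R]_(m, n)).
Proof. by move=> x0 i j; rewrite mxE. Qed.

Lemma mx_ge0D {m n : nat} (B C : 'M[R]_(m, n)) :
  mx_ge0 B -> mx_ge0 C -> mx_ge0 (B + C).
Proof. by move=> B0 C0 i j; rewrite mxE addr_ge0. Qed.

Lemma mx_ge0M {m n p : nat} (B : 'M[R]_(m, n)) (C : 'M[R]_(n, p)) :
  mx_ge0 B -> mx_ge0 C -> mx_ge0 (B *m C).
Proof. by move=> B0 C0 i j; rewrite mxE sumr_ge0// => k _; rewrite mulr_ge0. Qed.

Variables (d : nat) (B : 'M[R]_d).
Hypotheses (B_ge0 : mx_ge0 B) (B_lt1 : forall i, \sum_j B i j < 1).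

(* At an index i where x is minimal, x_i >= (B x)_i >= (row sum i of B) x_i. *)
Lemma subid_mulmx_ge0 {p : nat} (x : 'M[R]_(d, p)) :
  mx_ge0 ((1%:M - B) *m x) -> mx_ge0 x.
Proof.
move=> Bx i0 k.
have [i _ imin] := @arg_minP _ _ _ i0 xpredT (fun i => x i k) isT.
apply: le_trans (imin i0 isT).
have := Bx i k; rewrite mulmxBl mul1mx mxE [X in _ + X]mxE subr_ge0 mxE => le_x.
have le_sum : (\sum_j B i j) * x i k <= x i k.
  apply: le_trans le_x; rewrite mulr_suml; apply: ler_sum => j _.
  by apply: ler_wpM2l; [exact: B_ge0|exact: imin].
have := B_lt1 i; nra.
Qed.

(** If [x] is in the kernel, the previous lemma applies to both [x] and [- x], so [x = 0]. The
    transposes turn this column kernel into the row kernel that [inj_row_free] speaks of. *)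
Lemma subid_unitmx : 1%:M - B \in unitmx.
Proof.
rewrite -unitmx_tr -row_free_unit; apply: inj_row_free => v v0.
have Bv : (1%:M - B) *m v^T = 0 by rewrite -[LHS]trmxK trmx_mul trmxK v0 trmx0.
have ge0 : mx_ge0 v^T by apply: subid_mulmx_ge0; rewrite Bv => ? ?; rewrite mxE.
have le0 : mx_ge0 (- v^T).
  by apply: subid_mulmx_ge0; rewrite mulmxN Bv oppr0 => ? ?; rewrite mxE.
apply/rowP => i; have := ge0 i 0; have := le0 i 0; rewrite !mxE => le1 ge1.
by lra.
Qed.

Lemma invmx_subid_ge0 : mx_ge0 (invmx (1%:M - B)).
Proof.
apply: subid_mulmx_ge0; rewrite mulmxV ?subid_unitmx// => i j.
by rewrite mxE; case: (_ == _).
Qed.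

End NonnegativeMatrices.

Lemma sum_row_ones {R : realType} {d : nat} (B : 'M[R]_d) i :
  (B *m ones) i 0 = \sum_j B i j.
Proof. by rewrite mxE; apply: eq_bigr => j _; rewrite mxE mulr1. Qed.

(** * The transition operator on functions of the state *)

Section HalfStrip.
Variables (R : realType) (d : nat) (P Q T : nat -> 'M[R]_d).
Local Notation step := (@step R d P Q T).

(** A function on the states is stored as one column per layer, so that the blocks act on it by
    matrix products. *)
Definition trans (f : nat -> 'cV[R]_d) (n : nat) : 'cV[R]_d :=
  if n is m.+1 then Q n *m f m + T n *m f n + P n *m f n.+1 else P 0%N *m f 1%N.

Definition layer0 (n : nat) : 'cV[R]_d := const_mx (n == 0%N)%:R.

(** Links the block form to [step]. The walk climbs at most one layer, so the layers below [n.+2]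
    suffice and the sum is finite. *)
Lemma transE (f : nat -> 'cV[R]_d) n i :
  trans f n i 0 = \sum_(m < n.+2) \sum_j step (n, i) (val m, j) * f m j 0.
Proof.
case: n => [|n].
  rewrite !big_ord_recr big_ord0 /= add0r big1 ?add0r => [|j _].
    by rewrite mxE.
  by rewrite mul0r.
rewrite !big_ord_recr /= big1 ?add0r => [|m _]; last first.
  rewrite big1// => j _; rewrite !ifF ?mul0r//; apply/negbTE; rewrite neq_ltn.
  - by rewrite ltnS ltn_ord.
  - by rewrite (ltn_trans (ltn_ord m))// ltnW.
  - by rewrite (ltn_trans (ltn_ord m)).
rewrite !mxE; congr (_ + _ + _); apply: eq_bigr => j _; rewrite ?eqxx//.
- by rewrite !ifF//; apply/negbTE; rewrite neq_ltn ?ltnSn// ltnW.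
- by rewrite ifF//; apply/negbTE; rewrite neq_ltn ltnSn.
Qed.

Lemma transB (f g : nat -> 'cV[R]_d) n :
  trans (fun n => f n - g n) n = trans f n - trans g n.
Proof.
case: n => [|n] /=; rewrite !mulmxBr//.
by apply/matrixP => i j; rewrite !mxE; ring.
Qed.

Lemma trans_lincomb (c : 'I_d -> R) (f : 'I_d -> nat -> 'cV[R]_d) n :
  trans (fun n => \sum_k c k *: f k n) n = \sum_k c k *: trans (f k) n.
Proof.
have lincomb (B : 'M[R]_d) m :
    B *m (\sum_k c k *: f k m) = \sum_k c k *: (B *m f k m).
  by rewrite mulmx_sumr; apply: eq_bigr => k _; rewrite scalemxAr.
case: n => [|n] /=; rewrite !lincomb// -!big_split /=.
by apply: eq_bigr => k _; rewrite !scalerDr.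
Qed.

Lemma step_gt0_layer s t : 0 < step s t -> (t.1 < s.1.+2)%N.
Proof.
case: s t => [n i] [m j] /=; case: eqP => [->|_].
  by case: eqP => [->//|]; rewrite ltxx.
case: eqP => [->//|_]; case: eqP => [-> _|_]; first by rewrite ltnW.
by case: eqP => [<- _|]; [do 2 apply: ltnW|rewrite ltxx].
Qed.

Hypotheses (blk : blocks P Q T).

Let P_ge0 n : mx_ge0 (P n).
Proof. by case: blk => P0 _ H _; case: n => [|n]//; have [] := H n.+1 isT. Qed.
Let Q_ge0 n : mx_ge0 (Q n.+1).
Proof. by case: blk => _ _ H _; have [] := H n.+1 isT. Qed.
Let T_ge0 n : mx_ge0 (T n.+1).
Proof. by case: blk => _ _ H _; have [] := H n.+1 isT. Qed.
Let sum_ones n : P n.+1 *m ones + Q n.+1 *m ones + T n.+1 *m ones = ones.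
Proof. by case: blk => _ _ _ H; rewrite -!mulmxDl H. Qed.

Lemma step_ge0 s t : 0 <= step s t.
Proof.
case: s t => [[|n] i] [m j] /=; first by case: ifP => // _; exact: P_ge0.
by do 3 (case: ifP => [_|_]; first by [exact: P_ge0|exact: T_ge0|exact: Q_ge0]).
Qed.

Lemma trans_ge0 (f : nat -> 'cV[R]_d) n :
  (forall n, mx_ge0 (f n)) -> mx_ge0 (trans f n).
Proof.
by move=> f0; case: n => [|n] /=; repeat apply: mx_ge0D; exact: mx_ge0M.
Qed.

Lemma trans_ones n : trans (fun=> ones) n = ones.
Proof.
case: blk => _ P1 _ H; case: n => [|n]//=.
by rewrite -!mulmxDl [_ + P _]addrC addrA H.
Qed.

Lemma trans_gt0 (f : nat -> 'cV[R]_d) (s t : state d) :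
  (forall n, mx_ge0 (f n)) -> 0 < step s t -> 0 < f t.1 t.2 0 ->
  0 < trans f s.1 s.2 0.
Proof.
case: s t => [n i] [m j] f0 st ft; rewrite transE.
rewrite (bigD1 (Ordinal (step_gt0_layer st)))//= (bigD1 j)//= -addrA.
have sf_ge0 u v k : 0 <= step (n, i) (u, v) * f u v k.
  by rewrite mulr_ge0 ?step_ge0//; exact: f0.
rewrite ltr_pwDl ?mulr_gt0//; apply: addr_ge0.
  by apply: sumr_ge0 => ? _; exact: sf_ge0.
by do 2 apply: sumr_ge0 => ? _; exact: sf_ge0.
Qed.

(** * Superharmonic functions and irreducibility *)

Definition strictly_superharmonic_at (s : state d) : Prop :=
  exists w : nat -> 'cV[R]_d,
    [/\ forall n, mx_ge0 (w n), forall n, mx_ge0 (w n - trans w n)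
      & 0 < (w s.1 - trans w s.1) s.2 0].

(* If w witnesses the property at t, then trans w witnesses it at s. *)
Lemma strictly_superharmonic_step s t : 0 < step s t ->
  strictly_superharmonic_at t -> strictly_superharmonic_at s.
Proof.
move=> st [w [w0 wS wt]]; exists (trans w); split.
- by move=> n; exact: trans_ge0.
- by move=> n; rewrite -transB; exact: trans_ge0.
- by rewrite -transB; exact: (@trans_gt0 (fun n => w n - trans w n) _ t).
Qed.

Lemma strictly_superharmonic_accessible s t : accessible step s t ->
  strictly_superharmonic_at t -> strictly_superharmonic_at s.
Proof.
case=> l; elim: l s => [|u l IH] s /=; first by move=> _ ->.
case/andP=> su ul lt /(IH u ul lt); exact: strictly_superharmonic_step.
Qed.

(** By [C2] every state of layer [n.+1] has a predecessor in layer [n]. Tracing predecessors back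
    reaches layer 0, where [C3] applies. *)
Lemma accessible_from_layer0 : C2 P Q -> C3 P Q T ->
  forall i (t : state d), accessible step (0%N, i) t.
Proof.
move=> [c2 _] c3 i [n j]; elim: n j => [|n IH] j; first exact: c3.
have [k /andP[_ Pkj]] :=
  psumr_neq0P (fun k _ => P_ge0 n k j) (elimN eqP (lt0r_neq0 (c2 n j))).
have [l pl ll] := IH k; exists (rcons l (n.+1, j)); last by rewrite last_rcons.
rewrite rcons_path pl ll /=; by case: (n) Pkj => [|n'] //= Pkj; rewrite eqxx.
Qed.

(** Divide the witness at [(0, i)] by its defect [c i] there and sum over [i]: the term with index
    [j] alone gives the sum a defect of at least 1 at [(0, j)]. *)
Lemma superharmonic_layer0 :
  (forall i, strictly_superharmonic_at (0%N, i)) ->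
  exists w : nat -> 'cV[R]_d, (forall n, mx_ge0 (w n)) /\
    (forall n, mx_ge0 (w n - trans w n - layer0 n)).
Proof.
move=> /choice[w wP].
pose c i := (w i 0%N - trans (w i) 0%N) i 0.
have c0 i : 0 < c i by case: (wP i).
exists (fun n => \sum_i (c i)^-1 *: w i n); split=> n j k; rewrite (ord1 k).
  rewrite summxE sumr_ge0// => i _.
  rewrite mxE mulr_ge0 ?invr_ge0 ?(ltW (c0 i))//.
  by case: (wP i) => + _ _; apply.
rewrite trans_lincomb -sumrB.
under eq_bigr => i _ do rewrite -scalerBr.
rewrite mxE summxE [X in _ + X]mxE subr_ge0 mxE.
have ge0 i : 0 <= ((c i)^-1 *: (w i n - trans (w i) n)) j 0.
  rewrite mxE mulr_ge0 ?invr_ge0 ?(ltW (c0 i))//.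
  by case: (wP i) => _ + _; apply.
case: n ge0 => [|n] ge0 /=; last exact: sumr_ge0.
rewrite (bigD1 j)//= -[leLHS]addr0 lerD ?sumr_ge0//.
by rewrite mxE mulVf// lt0r_neq0.
Qed.

(** * Probabilities of avoiding a layer *)

(* avoid y N n i is the probability that the walk started in (n, i) is outside
   of layer y at the times 1, ..., N. *)
Definition off (y : nat) (f : nat -> 'cV[R]_d) (n : nat) : 'cV[R]_d :=
  if n == y then 0 else f n.

Fixpoint avoid (y N : nat) : nat -> 'cV[R]_d :=
  if N is N'.+1 then trans (off y (avoid y N')) else fun=> ones.

Lemma avoid_ge0 y N n : mx_ge0 (avoid y N n).
Proof.
elim: N n => [|N IH] n /=; first by move=> i j; rewrite mxE ler01.
apply: trans_ge0 => m; rewrite /off; case: ifP => // _ i j; by rewrite mxE.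
Qed.

Lemma cvg_trans_layers (f : nat -> nat -> 'cV[R]_d) (g : nat -> 'cV[R]_d) n i :
  (forall m j, f k m j 0 @[k --> \oo] --> g m j 0) ->
  trans (f k) n i 0 @[k --> \oo] --> trans g n i 0.
Proof.
move=> fg; rewrite transE; under eq_fun do rewrite transE.
apply: cvg_big => [|m _]; first exact: add_continuous.
apply: cvg_big => [|j _]; first exact: add_continuous.
by apply: cvgMl_tmp; exact: fg.
Qed.

(** With [h] the probability of avoiding [y] at all positive times, [ones - off y h] is the
    probability of being in [y] at some time from 0 on. Its defect is [h] on layer [y] and 0
    elsewhere. *)
Lemma strictly_superharmonic_avoid y (h : nat -> 'cV[R]_d) (i : 'I_d) :
  (forall n, mx_ge0 (ones - h n)) ->
  (forall n, mx_ge0 (h n)) ->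
  (forall n j, avoid y k n j 0 @[k --> \oo] --> h n j 0) ->
  h y i 0 != 0 -> strictly_superharmonic_at (y, i).
Proof.
move=> h1 h0 uh hy.
(* Both sides are limits of [avoid y k.+1 n]. *)
have hE n : h n = trans (off y h) n.
  apply/colP => j; apply: (@cvg_unique R _ (avoid y k.+1 n j 0 @[k --> \oo])).
  - exact: norm_hausdorff.
  - have E := cvg_shiftS (fun k => avoid y k n j 0 : R) (nbhs (h n j 0)).
    by move: (uh n j); rewrite -E.
  apply: cvg_trans_layers => m l; rewrite /off.
  by case: ifP => _; [exact: cvg_cst|exact: uh].
pose g n : 'cV[R]_d := ones - off y h n.
have gE n : g n - trans g n = h n - off y h n.
  rewrite /g transB trans_ones -hE.
  by apply/matrixP => a b; rewrite !mxE; ring.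
exists g; split.
- move=> n; rewrite /g /off; case: ifP => // _ a b.
  by rewrite subr0 mxE ler01.
- move=> n; rewrite gE /off; case: ifP => _; first by rewrite subr0.
  by rewrite subrr => a b; rewrite mxE.
- by rewrite gE /off eqxx subr0 lt0r hy; exact: h0.
Qed.

(** * The matrices [zeta] and [A_plus], and the partial sums of beta *)

Hypothesis c1 : C1 P Q T.

Local Notation zet := (zeta P Q T).
Local Notation down n := (Q n.+1 *m zet n + T n.+1).
Local Notation v k := (A_prod P Q T k *m ones).

Let QT_lt1 n i : \sum_j (T n.+1 + Q n.+1) i j < 1.
Proof.
have [_] := c1 (isT : (0 < n.+1)%N); apply: le_lt_trans.
apply: le_trans (le_bigmax 0 (fun i => \sum_(j < d) `|(T n.+1 + Q n.+1) i j|) i).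
by apply: ler_sum => j _; apply: ler_norm.
Qed.

Let subE n : 1%:M - Q n.+1 *m zet n - T n.+1 = 1%:M - down n.
Proof. by rewrite opprD addrA. Qed.

(** Since [zet n] fixes [ones], [down n] has the row sums of [T n.+1 + Q n.+1], which [C1] puts
    below 1. Hence [1%:M - down n] has a nonnegative inverse, and it maps [ones] to
    [P n.+1 *m ones]. *)
Lemma zeta_stochastic n : mx_ge0 (zet n) /\ zet n *m ones = ones.
Proof.
elim: n => [|n [z0 z1]]; first by case: blk.
have B0 : mx_ge0 (down n) by apply: mx_ge0D => //; apply: mx_ge0M.
have BE : down n *m ones = (T n.+1 + Q n.+1) *m ones.
  by rewrite !mulmxDl -mulmxA z1 addrC.
have B1 i : \sum_j (down n) i j < 1 by rewrite -sum_row_ones BE sum_row_ones.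
rewrite /= subE; split.
  by apply: mx_ge0M => //; exact: invmx_subid_ge0.
rewrite -mulmxA.
have -> : P n.+1 *m ones = (1%:M - down n) *m ones.
  apply/eqP; rewrite mulmxBl mul1mx BE mulmxDl eq_sym subr_eq.
  by rewrite -[X in X == _](sum_ones n) -addrA [Q _ *m _ + _]addrC.
by rewrite mulKmx// subid_unitmx.
Qed.

Let down_ge0 n : mx_ge0 (down n).
Proof.
by apply: mx_ge0D => //; apply: mx_ge0M => //; case: (zeta_stochastic n).
Qed.

Let down_lt1 n i : \sum_j (down n) i j < 1.
Proof.
rewrite -sum_row_ones mulmxDl -mulmxA; case: (zeta_stochastic n) => _ ->.
by rewrite -mulmxDl sum_row_ones addrC.
Qed.

Lemma zetaS n : (1%:M - down n) *m zet n.+1 = P n.+1.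
Proof. by rewrite /= subE mulKVmx// subid_unitmx. Qed.

Lemma A_prod_onesS n : (1%:M - down n) *m v n.+1 = Q n.+1 *m v n.
Proof. by rewrite /= /A_plus subE -2!mulmxA mulKVmx// subid_unitmx. Qed.

Lemma A_prod_ones_ge0 n : mx_ge0 (v n).
Proof.
elim: n => [|n IH].
  by rewrite mul1mx; apply: mx_ge0_const; exact: ler01.
rewrite -[v n.+1](mulKmx (subid_unitmx (down_ge0 n) (down_lt1 n))) A_prod_onesS.
apply: mx_ge0M; first exact: invmx_subid_ge0.
exact: mx_ge0M.
Qed.

(* green K n lists the expected numbers of visits to layer 0 before the walk
   started in layer n reaches layer n + K. *)
Fixpoint green (K n : nat) : 'cV[R]_d :=
  if K is K'.+1 then v n + zet n *m green K' n.+1 else 0.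

Lemma green_ge0 K n : mx_ge0 (green K n).
Proof.
elim: K n => [|K IH] n /=; first by move=> i j; rewrite mxE.
apply: mx_ge0D; first exact: A_prod_ones_ge0.
by apply: mx_ge0M => //; case: (zeta_stochastic n).
Qed.

Lemma green0 K : green K.+1 0 = layer0 0 + P 0%N *m green K 1.
Proof. by rewrite /= mul1mx. Qed.

(** The indices [K.+2], [K.+1] and [K] all aim at the same layer [n + K.+2]: this is harmonicity
    between layer 0 and that layer. Multiplying the recursion of [green] by [1%:M - down n] clears
    the inverses. *)
Lemma greenS K n : green K.+1 n.+1 =
  Q n.+1 *m green K.+2 n + T n.+1 *m green K.+1 n.+1 + P n.+1 *m green K n.+2.
Proof.
have : (1%:M - down n) *m green K.+1 n.+1 =
       Q n.+1 *m v n + P n.+1 *m green K n.+2.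
  have -> : green K.+1 n.+1 = v n.+1 + zet n.+1 *m green K n.+2 by [].
  by rewrite mulmxDr A_prod_onesS [in X in _ + X = _]mulmxA zetaS.
have -> : green K.+2 n = v n + zet n *m green K.+1 n.+1 by [].
move: (green K.+1 n.+1) (green K n.+2) => g g' /eqP.
rewrite mulmxBl mul1mx subr_eq mulmxDl => /eqP {1}->; rewrite mulmxDr !mulmxA.
by apply/matrixP => i j; rewrite !mxE; ring.
Qed.

(** A general starting layer [n] lets the induction on [K] split off the first term; [n = 0] gives
    the partial sums of beta. *)
Lemma mu_green (mu : 'rV[R]_d) K n :
  (mu_at P Q T mu n *m green K n) 0 0 =
  \sum_(n <= k < n + K) (mu_at P Q T mu k *m A_prod P Q T k *m ones) 0 0.
Proof.
elim: K n => [|K IH] n; first by rewrite addn0 big_geq// mulmx0 mxE.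
rewrite big_ltn ?addnS ?ltnS ?leq_addr// -addSn -IH /= mulmxDr mxE !mulmxA.
by [].
Qed.

Lemma mu_at_ge0 (mu : 'rV[R]_d) n :
  (forall i, 0 <= mu 0 i) -> mx_ge0 (mu_at P Q T mu n).
Proof.
move=> mu0; elim: n => [|n IH] /=; first by move=> i j; rewrite (ord1 i).
by apply: mx_ge0M => //; case: (zeta_stochastic n).
Qed.

(** Multiplied by [1%:M - down n], the difference at [n.+1] becomes the superharmonic defect there
    plus [Q n.+1] times the difference at [n]. Both are nonnegative, and [subid_mulmx_ge0] removes
    the factor. *)
Lemma superharmonic_ge (w : nat -> 'cV[R]_d) n :
  (forall n, mx_ge0 (w n - trans w n - layer0 n)) ->
  mx_ge0 (w n - zet n *m w n.+1 - v n).
Proof.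
move=> wS; elim: n => [|n IH]; first by have := wS 0%N; rewrite mul1mx.
apply: (subid_mulmx_ge0 (down_ge0 n) (down_lt1 n)).
rewrite !mulmxBr mulmxA zetaS A_prod_onesS.
suff -> : (1%:M - down n) *m w n.+1 - P n.+1 *m w n.+2 - Q n.+1 *m v n =
    (w n.+1 - trans w n.+1 - layer0 n.+1)
    + Q n.+1 *m (w n - zet n *m w n.+1 - v n).
  by apply: mx_ge0D => //; apply: mx_ge0M.
rewrite /trans /layer0 /= !mulmxBr mulmxBl mulmxDl mul1mx !mulmxA.
have -> : const_mx 0 = 0 :> 'cV[R]_d by apply/matrixP => i j; rewrite !mxE.
by apply/matrixP => i j; rewrite !mxE; ring.
Qed.

Lemma superharmonic_bound (w : nat -> 'cV[R]_d) (mu : 'rV[R]_d) K :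
  (forall n, mx_ge0 (w n)) ->
  (forall n, mx_ge0 (w n - trans w n - layer0 n)) ->
  (forall i, 0 <= mu 0 i) ->
  \sum_(0 <= k < K) (mu_at P Q T mu k *m A_prod P Q T k *m ones) 0 0 <=
  (mu *m w 0%N) 0 0.
Proof.
move=> w0 wS mu0.
(* The remainder at layer [K] is kept so that the induction telescopes. *)
suff : \sum_(0 <= k < K) (mu_at P Q T mu k *m A_prod P Q T k *m ones) 0 0
   + (mu_at P Q T mu K *m w K) 0 0 <= (mu *m w 0%N) 0 0.
  by apply: le_trans; rewrite lerDl; apply: mx_ge0M => //; apply: mu_at_ge0.
elim: K => [|K IH]; first by rewrite big_geq// add0r.
rewrite big_nat_recr//=; apply: le_trans IH; rewrite -addrA lerD2l.
have := mx_ge0M (mu_at_ge0 K mu0) (superharmonic_ge K wS) 0 0.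
rewrite !mulmxBr !mulmxA mxE [X in _ + X]mxE [X in X + _]mxE [X in _ + X + _]mxE.
lra.
Qed.

(* Within N <= J steps the walk started in layer n stays below layer n + J + 1,
   so green J.+1 n counts every visit to layer 0 made by then. *)
Lemma green_ge_avoid K N J n (c : R) : 0 <= c ->
  (forall i, c <= green K.+1 0%N i 0) -> (N <= J)%N -> (n + J)%N = K ->
  mx_ge0 (green J.+1 n - layer0 n - c *: (ones - avoid 0 N n)).
Proof.
move=> c0 cK; elim: N J n => [|N IH] J n.
  move=> _ _; rewrite subrr scaler0 subr0; case: n => [|n].
    rewrite green0 addrAC subrr add0r; apply: mx_ge0M => //; exact: green_ge0.
  have -> : layer0 n.+1 = 0 by apply/matrixP => i j; rewrite !mxE.
  by rewrite subr0; exact: green_ge0.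
case: J => // J NJ nJ.
(* Outside layer 0 this is [IH]. On layer 0 the walk has returned, [off] vanishes, and the bound is
   [cK] with [L = K]. *)
have IH' m L : (N <= L)%N -> (m + L)%N = K ->
    mx_ge0 (green L.+1 m - c *: (ones - off 0 (avoid 0 N) m)).
  move=> NL mL; have := IH _ _ NL mL; case: m mL => [mL _ i j|m mL]; last first.
    have -> : layer0 m.+1 = 0 by apply/matrixP => i j; rewrite !mxE.
    by rewrite subr0.
  rewrite /off eqxx subr0 (ord1 j); have := cK i; rewrite -mL.
  by move: (green _ _) => g cg; rewrite !mxE mulr1 subr_ge0.
(* Now [ones - avoid 0 N.+1] is [trans] applied to [ones - off 0 (avoid 0 N)], so the claim follows
   by applying [trans] to [IH']. *)
rewrite -[in ones - _](trans_ones n) [avoid _ _ _]/= -transB.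
case: n nJ => [|n] nJ.
  rewrite green0 [layer0 _ + _]addrC addrK /= scalemxAr -mulmxBr.
  by apply: mx_ge0M => //; exact: (IH' 1%N J NJ nJ).
have -> : layer0 n.+1 = 0 by apply/matrixP => i j; rewrite !mxE.
rewrite subr0 greenS//.
have := IH' n J.+2; have := IH' n.+1 J.+1; have := IH' n.+2 J.
move: (green J.+3 n) (green J.+2 n.+1) (green J.+1 n.+2) => g1 g2 g3 H3 H2 H1.
pose x m g := g - c *: (ones - off 0 (avoid 0 N) m) : 'cV[R]_d.
have -> : Q n.+1 *m g1 + T n.+1 *m g2 + P n.+1 *m g3
    - c *: trans (fun n => ones - off 0 (avoid 0 N) n) n.+1 =
    Q n.+1 *m x n g1 + T n.+1 *m x n.+1 g2 + P n.+1 *m x n.+2 g3.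
  rewrite /x /trans !(mulmxBr _ _ (c *: _)) -!scalemxAr.
  by apply/matrixP => i j; rewrite !mxE; ring.
repeat apply: mx_ge0D; apply: mx_ge0M => //.
- by apply: H1; rewrite -?nJ ?addSnnS// leqW// ltnW.
- by apply: H2; rewrite -?nJ ?addSnnS// ltnW.
- by apply: H3; rewrite -?nJ ?addSnnS.
Qed.

End HalfStrip.

Arguments layer0 {R d} n.

(** * Probabilities of trajectories of the chain *)

Section Chain.
Variables (R : realType) (d : nat) (P Q T : nat -> 'M[R]_d).
Hypotheses (blk : blocks P Q T).
Local Notation avoid := (avoid P Q T).
Local Notation trans := (trans P Q T).
Local Notation step := (@step R d P Q T).

Definition neighbours (s : state d) : seq (state d) :=
  [seq (val m, j) | m <- enum 'I_s.1.+2, j <- enum 'I_d].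

Lemma neighbours_uniq s : uniq (neighbours s).
Proof.
apply: allpairs_uniq; [exact: enum_uniq|exact: enum_uniq|].
by move=> [m j] [m' j'] _ _ /= [/val_inj -> ->].
Qed.

Lemma trans_neighbours (f : nat -> 'cV[R]_d) s :
  trans f s.1 s.2 0 = \sum_(t <- neighbours s) step s t * f t.1 t.2 0.
Proof.
case: s => n i; rewrite transE /neighbours big_allpairs_dep big_enum /=.
by apply: eq_bigr => m _; rewrite big_enum.
Qed.

Variables (disp : measure_display) (Omega : measurableType disp).
Variables (X : nat -> Omega -> state d) (Pr : probability Omega R).
Variable (init : state d -> R).
Hypothesis (mc : markov_chain Pr X init step).

Lemma measurable_state n (A : set (state d)) : measurable (X n @^-1` A).
Proof.
have -> : X n @^-1` A = \bigcup_(s in A) X n @^-1` [set s].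
  apply/seteqP; split=> [w Aw|w [s As ws]]; first by exists (X n w).
  by rewrite /preimage/= ws.
rewrite bigcup_mkcond; apply: countable_bigcupT_measurable => [|s].
  exact: countableP.
by case: ifP => // _; case: mc.
Qed.

Lemma measurable_trajectory n s : measurable (trajectory X n s).
Proof.
have -> : trajectory X n s = \bigcap_(k in `I_n.+1) X k @^-1` [set s k].
  by apply/seteqP; split.
by apply: bigcap_measurableType => k _; exact: measurable_state.
Qed.

Lemma probability_split n (r : seq (state d)) (C : set Omega) :
  uniq r -> measurable C ->
  (Pr C = \sum_(t <- r) Pr (C `&` X n @^-1` [set t])
         + Pr (C `&` X n @^-1` [set t | t \notin r]))%E.
Proof.
move=> + mC; elim: r => [|t r IH] /=.
  by move=> _; rewrite big_nil add0e; congr (Pr _); apply/seteqP; split=> // w [].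
case/andP=> tr /IH ->; rewrite big_cons.
rewrite (measureDI Pr (measurableI _ _ mC (measurable_state _ _))
  (measurable_state n [set t])).
rewrite [RHS]addeAC [RHS]addeC; congr (_ + _)%E.
rewrite [RHS]addeC; congr (Pr _ + Pr _)%E; apply/seteqP; split=> w /=.
- case=> -[Cw /negP wr] wt; split=> //; rewrite inE negb_or.
  by apply/andP; split; [apply/eqP|apply/negP].
- by case=> Cw; rewrite inE negb_or => /andP[/eqP wt wr].
- by case=> -[Cw _] wt.
- by case=> Cw ->; split.
Qed.

Definition extend (s : nat -> state d) (n : nat) (t : state d) (k : nat) :=
  if k == n.+1 then t else s k.

Lemma trajectory_extend s n t :
  trajectory X n s `&` X n.+1 @^-1` [set t] = trajectory X n.+1 (extend s n t).
Proof.
apply/seteqP; split=> w.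
  case=> sw tw k; rewrite leq_eqVlt /extend; case: eqP => [->//|_] /=.
  by rewrite ltnS; exact: sw.
move=> ew; split=> [k kn|] /=; last by rewrite ew// /extend eqxx.
by rewrite ew ?leqW// /extend ifF//; apply/negbTE; rewrite neq_ltn ltnS kn.
Qed.

Lemma probability_extend s n t :
  Pr (trajectory X n.+1 (extend s n t)) =
  (Pr (trajectory X n s) * (step (s n) t)%:E)%E.
Proof.
case: mc => _ _ ->; rewrite /extend eqxx ifF; last first.
  by apply/negbTE; rewrite neq_ltn ltnSn.
congr (Pr _ * _)%E; apply/seteqP; split=> w sw k kn.
all: by move: (sw k kn); rewrite ifF//; apply/negbTE; rewrite neq_ltn ltnS kn.
Qed.

Lemma step_neighbours s : \sum_(t <- neighbours s) step s t = 1.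
Proof.
transitivity (trans (fun=> ones) s.1 s.2 0); last by rewrite trans_ones// mxE.
by rewrite trans_neighbours; apply: eq_bigr => t _; rewrite mxE mulr1.
Qed.

(** The transition probabilities over [neighbours] already sum to 1, so a step outside this list is
    a null event and a finite sum suffices. *)
Lemma trajectory_neighbours n s (C : set Omega) :
  measurable C -> C `<=` trajectory X n s ->
  Pr C = (\sum_(t <- neighbours (s n)) Pr (C `&` X n.+1 @^-1` [set t]))%E.
Proof.
move=> mC sC; rewrite {1}(probability_split n.+1 (neighbours_uniq (s n)) mC).
rewrite (_ : Pr (C `&` _) = 0%E) ?adde0//.
have mo := measurable_state n.+1 [set t | t \notin neighbours (s n)].
have mt := measurable_trajectory n s.
apply/eqP; rewrite -measure_le0.
apply: (@le_trans _ _ (Pr (trajectory X n s `&`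
    X n.+1 @^-1` [set t | t \notin neighbours (s n)]))).
  apply: le_measure; rewrite ?inE; [exact: measurableI|exact: measurableI|].
  exact: setSI.
(* For the whole trajectory the splitting reads [x = x + a] with [x] finite, which forces
   [a = 0]. *)
have := probability_split n.+1 (neighbours_uniq (s n)) mt.
under eq_bigr do rewrite trajectory_extend probability_extend.
rewrite -ge0_sume_distrr; last by move=> t _; rewrite lee_fin step_ge0.
rewrite sumEFin step_neighbours mule1.
set a := Pr (_ `&` _).
have : a \is a fin_num by rewrite fin_num_measure//; exact: measurableI.
have : Pr (trajectory X n s) \is a fin_num by rewrite fin_num_measure.
case: (Pr _) a => [x| |] [z| |]//= _ _ [] xz; rewrite lee_fin; lra.
Qed.

Definition stay_off (y n N : nat) : set Omega :=
  [set w | forall k, (n < k <= n + N)%N -> (X k w).1 <> y].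

Lemma measurable_stay_off y n N : measurable (stay_off y n N).
Proof.
have -> : stay_off y n N =
    \bigcap_(k in [set k | n < k <= n + N]%N) X k @^-1` [set t | t.1 <> y].
  by apply/seteqP; split.
by apply: bigcap_measurableType => k _; exact: measurable_state.
Qed.

Lemma stay_offS y n N :
  stay_off y n N.+1 = X n.+1 @^-1` [set t | t.1 <> y] `&` stay_off y n.+1 N.
Proof.
apply/seteqP; split=> w.
  move=> wy; split=> [|k /andP[nk kN]].
    by apply: wy; rewrite ltnSn addnS ltnS leq_addr.
  by apply: wy; rewrite (ltnW nk) addnS -addSn.
case=> w1 wy k /andP[nk kN]; have [->//|kn] := eqVneq k n.+1.
by apply: wy; rewrite ltn_neqAle eq_sym kn nk addSnnS.
Qed.

(** First-step analysis: split by the state at time [n.+1]. If it lies in layer [y] the event is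
    empty, as [off] records; otherwise the induction hypothesis applies to the extended
    trajectory. *)
Lemma probability_stay_off y N n s :
  Pr (trajectory X n s `&` stay_off y n N) =
  (Pr (trajectory X n s) * (avoid y N (s n).1 (s n).2 0)%:E)%E.
Proof.
elim: N n s => [|N IH] n s.
  rewrite mxE mule1; congr (Pr _); apply/seteqP; split=> w; first by case.
  by move=> sw; split=> // k; rewrite addn0 ltnNge andNb.
have mC : measurable (trajectory X n s `&` stay_off y n N.+1).
  exact: measurableI (measurable_trajectory _ _) (measurable_stay_off _ _ _).
rewrite (@trajectory_neighbours n s _ mC); last by move=> w [].
rewrite [avoid _ _]/= trans_neighbours -sumEFin.
rewrite ge0_sume_distrr; last first.
  move=> t _; rewrite lee_fin mulr_ge0 ?step_ge0// /off; case: ifP => _.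
    by rewrite mxE.
  exact: avoid_ge0.
apply: eq_bigr => t _.
rewrite setIAC trajectory_extend stay_offS EFinM muleA -probability_extend.
rewrite /off; case: eqP => ty.
  rewrite mxE mule0 (_ : _ `&` _ = set0) ?measure0//.
  apply/seteqP; split=> // w [/(_ n.+1 (leqnn _))].
  by rewrite /extend eqxx /= => -> [].
have := IH n.+1 (extend s n t); rewrite {3 4}/extend eqxx => <-; congr (Pr _).
rewrite setIA; congr (_ `&` _); apply/seteqP; split=> w; first by case.
move=> ew; split=> //=; have := ew n.+1 (leqnn _).
by rewrite /extend eqxx => ->.
Qed.

End Chain.

(** * Return probabilities of the walk started at a state *)

Section Return.
Variables (R : realType) (d : nat) (P Q T : nat -> 'M[R]_d).
Hypotheses (blk : blocks P Q T).
Local Notation avoid := (avoid P Q T).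
Variables (disp : measure_display) (Omega : measurableType disp).
Variables (X : nat -> Omega -> state d) (Pr : probability Omega R).

Definition never_in (y : nat) : set Omega :=
  [set w | forall k, (0 < k)%N -> (X k w).1 <> y].

Lemma never_in_bigcap y : never_in y = \bigcap_N stay_off X y 0 N.
Proof.
apply/seteqP; split=> w wy; first by move=> N _ k /andP[+ _]; exact: wy.
by move=> k k0; apply: (wy k) => //; rewrite k0 add0n leqnn.
Qed.

Variable s : state d.
Hypothesis (mc : markov_chain Pr X (init_at s) (step P Q T)).

Lemma measurable_never_in y : measurable (never_in y).
Proof.
rewrite never_in_bigcap; apply: bigcapT_measurable => N.
exact: (measurable_stay_off mc).
Qed.

Lemma probability_stay_off_start y N :
  Pr (stay_off X y 0 N) = (avoid y N s.1 s.2 0)%:E.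
Proof.
have mst := measurable_stay_off mc y 0 N.
have mt := measurable_trajectory mc 0 (fun=> s).
have t1 : Pr (trajectory X 0 (fun=> s)) = 1%E.
  have -> : trajectory X 0 (fun=> s) = X 0%N @^-1` [set s].
    by apply/seteqP; split=> w sw => [|k]; [exact: sw|rewrite leqn0 => /eqP ->].
  by case: mc => _ -> _; rewrite /init_at eqxx.
have := probability_stay_off blk mc y N 0 (fun=> s).
rewrite t1 mul1e => <-.
rewrite [LHS](measureDI Pr mst mt) setIC [X in (X + _)%E](_ : _ = 0%E) ?add0e//.
apply/eqP; rewrite -measure_le0.
apply: (@le_trans _ _ (Pr (~` trajectory X 0 (fun=> s)))).
  apply: le_measure; rewrite ?inE; [exact: measurableD|exact: measurableC|].
  by move=> w [].
by rewrite probability_setC// t1 subee.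
Qed.

(** Continuity from above along the decreasing events [stay_off X y 0 N]. *)
Lemma cvg_avoid y : avoid y N s.1 s.2 0 @[N --> \oo] --> fine (Pr (never_in y)).
Proof.
have mst N := measurable_stay_off mc y 0 N.
have mn := measurable_never_in y.
have : Pr (stay_off X y 0 N) @[N --> \oo] --> Pr (never_in y).
  rewrite never_in_bigcap; apply: nonincreasing_cvg_mu => //.
  - by rewrite -ge0_fin_numE// fin_num_measure.
  - by rewrite -never_in_bigcap.
  - move=> N M NM; apply/subsetPset => w wy k /andP[k0 kN]; apply: wy.
    by rewrite k0 (leq_trans kN)// leq_add2l.
under eq_fun do rewrite probability_stay_off_start.
rewrite -[Pr (never_in y)]fineK ?fin_num_measure//.
by move/fine_cvgP => [].
Qed.

Lemma probability_return y :
  Pr [set w | exists2 n, (0 < n)%N & (X n w).1 = y] = 1%E <->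
  fine (Pr (never_in y)) = 0.
Proof.
have mn := measurable_never_in y.
have -> : [set w | exists2 n, (0 < n)%N & (X n w).1 = y] = ~` never_in y.
  apply/seteqP; split=> w; first by move=> [n n0 wy] /(_ n n0).
  move=> nw; apply: contrapT => no; apply: nw => k k0 wy; apply: no.
  by exists k.
rewrite probability_setC//.
have : Pr (never_in y) \is a fin_num by rewrite fin_num_measure.
case: (Pr _) => //= r _; rewrite -EFinB; split=> [[]|->]; last by rewrite subr0.
by lra.
Qed.

End Return.

Theorem theorem1p1 (R : realType) (d : nat) (d_gt0 : (0 < d)%N)
    (P Q T : nat -> 'M[R]_d) (mu : 'rV[R]_d)
    (disp : measure_display) (Omega : measurableType disp)
    (X : nat -> Omega -> state d)
    (Prmu : probability Omega R) (Prs : state d -> probability Omega R) :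
  blocks P Q T -> C1 P Q T -> C2 P Q -> C3 P Q T ->
  distribution_row mu ->
  markov_chain Prmu X (init_layer0 mu) (step P Q T) ->
  (forall s, markov_chain (Prs s) X (init_at s) (step P Q T)) ->
  recurrent Prs X <-> beta_plus P Q T mu = +oo%E.
Proof.
move=> blk c1 c2 c3 [mu0 mu1] _ mc.
have term_ge0 k : 0 <= (mu_at P Q T mu k *m A_prod P Q T k *m ones) 0 0.
  rewrite -mulmxA; apply: mx_ge0M; first exact: mu_at_ge0.
  exact: A_prod_ones_ge0.
have cvg_s := fun s => cvg_avoid blk (mc s).
have ret y i := probability_return (mc (y, i)) y.
split=> [rec|beta_oo y i].
  (* It suffices that beta exceeds every [A > 0]; the bound on the probability of no return within
     [N] steps is taken as [A^-1]. *)
  apply/eqyP => A A0.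
  have : \forall N \near \oo, forall i : 'I_d, avoid P Q T 0 N 0 i 0 <= A^-1.
    apply: filter_forall => i.
    have := cvg_s (0%N, i) 0%N; have /ret -> := rec 0%N i.
    move=> /cvgrPdist_le /(_ A^-1); rewrite invr_gt0 => /(_ A0).
    by apply: filterS => N; rewrite sub0r normrN => /(le_trans (ler_norm _)).
  move=> /filter_ex[N avoidN].
  have [i _ imin] :=
    @arg_minP _ _ _ (Ordinal d_gt0) xpredT (fun i => green P Q T N.+1 0 i 0) isT.
  set c := green P Q T N.+1 0 i 0 in imin.
  have c0 : 0 <= c by exact: green_ge0.
  have Ac : A <= c.
    have entry (g l u : 'cV[R]_d) : mx_ge0 (g - l - c *: (ones - u)) ->
        l i 0 <= g i 0 - c * (1 - u i 0).
      by move=> /(_ i 0); rewrite !mxE; lra.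
    (* With [n = 0] and [J = K = N], the entry at the minimizing [i] gives
       [1 <= c * avoid <= c / A]. *)
    have /entry := green_ge_avoid blk c1 c0 (fun j => imin j isT) (leqnn N)
      (add0n N).
    rewrite mxE -/c /= => ca; have caA := ler_wpM2l c0 (avoidN i).
    by rewrite -[A]mul1r -ler_pdivlMr//; lra.
  (* The partial sum of the first [N.+1] terms is the [mu]-average of [green] on layer 0, hence at
     least its minimum [c]. *)
  apply: le_trans (nneseries_lim_ge N.+1 _); last first.
    by move=> k _ _; rewrite lee_fin.
  rewrite sumEFin lee_fin -[N.+1]add0n -mu_green// mxE.
  apply: le_trans Ac _; rewrite -[c]mul1r -mu1 mulr_suml; apply: ler_sum => j _.
  by apply: ler_wpM2l; [exact: mu0|exact: (imin j isT)].
apply/ret; apply/eqP/negP => /negP h_neq0.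
pose h n : 'cV[R]_d := \col_j fine (Prs (n, j) (never_in X y)).
have mnever n j := measurable_never_in (mc (n, j)) y.
have sh : strictly_superharmonic_at P Q T (y, i).
  apply: (strictly_superharmonic_avoid blk (y := y) (h := h)).
  - move=> n j k; have mn := mnever n j; rewrite !mxE subr_ge0 -lee_fin.
    by rewrite fineK ?fin_num_measure// probability_le1.
  - by move=> n j k; rewrite mxE fine_ge0.
  - by move=> n j; rewrite mxE; exact: (cvg_s (n, j)).
  - by rewrite mxE.
have [w [w0 wS]] : exists w : nat -> 'cV[R]_d, (forall n, mx_ge0 (w n)) /\
    (forall n, mx_ge0 (w n - trans P Q T w n - layer0 n)).
  apply: superharmonic_layer0 => // j.
  apply: strictly_superharmonic_accessible sh => //.
  exact: accessible_from_layer0.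
(* All partial sums lie below one finite number, so beta cannot be infinite. *)
suff : (beta_plus P Q T mu <= ((mu *m w 0%N) 0 0)%:E)%E by rewrite beta_oo.
apply: lime_le; first by apply: is_cvg_nneseries => k _ _; rewrite lee_fin.
by apply: nearW => K; rewrite sumEFin lee_fin; exact: superharmonic_bound.
Qed.
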